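(* Let $n\ge1$ be an integer. Let $(R_t)_{t=1}^\infty$ be a sequence of $M_t\times N_t$ rectangles such that $M_t\to\infty$ and $N_t\to\infty$ as $t\to\infty$, and such that every $R_t$ is tileable by $n$-ribbons. Then the limit $\mu^{(n)}(R_t)=\lim_{t\to\infty}\frac{\log_2|\mathcal{T}_n(R_t)|}{M_tN_t/n}$ satisfies $$\mu^{(n)}(R_t)\ \ge\ \log_2 n-\log_2 e+\frac1n\Big(\frac12\log_2 n+\log_2\sqrt{2\pi}\Big).$$
   Context: An $M\times N$ rectangle is the rectangle made of unit squares of the square lattice with $M$ rows and $N$ columns. An $n$-ribbon is a connected sequence of $n$ unit squares of the lattice, each of which (except the first) lies directly above or directly to the right of its predecessor. A tiling of a region by $n$-ribbons is a set of $n$-ribbons with pairwise disjoint interiors whose union is the region; a region is tileable if it has at least one such tiling. $\mathcal{T}_n(R)$ is the set of all tilings of $R$ by $n$-ribbons. It is a known fact that, under the stated hypotheses, the limit defining $\mu^{(n)}(R_t)$ exists and is finite. *)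

(* Defs.v *)
From mathcomp Require Import all_boot all_order all_algebra.
From mathcomp Require Import all_classical all_reals all_analysis.

Set Implicit Arguments.
Unset Strict Implicit.
Unset Printing Implicit Defensive.

Import Order.TTheory GRing.Theory Num.Theory.
Import numFieldNormedType.Exports.

(* The square (i, j) is the one in row i, column j, with rows numbered from
   bottom to top and columns from left to right, so that moving up increments
   the first coordinate. *)
Definition cell (M N : nat) : finType := ('I_M * 'I_N)%type.

Definition directly_above M N : rel (cell M N) :=
  fun c d => (d.1 == c.1.+1 :> nat) && (d.2 == c.2 :> nat).

Definition directly_right M N : rel (cell M N) :=
  fun c d => (d.1 == c.1 :> nat) && (d.2 == c.2.+1 :> nat).

(* A ribbon is identified with its set of squares: these determine the sequence,
   since the sum of the coordinates increases by one at each step. *)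
Definition is_ribbon (n M N : nat) (B : {set cell M N}) : bool :=
  [exists s : n.-tuple (cell M N),
    sorted (fun c d => directly_above c d || directly_right c d) s
    && (B == [set c in s])].

Definition ribbon_tilings (n M N : nat) : {set {set {set cell M N}}} :=
  [set P : {set {set cell M N}} |
     finset.partition P [set: cell M N] & [forall B in P, is_ribbon n B]].

Definition tileable (n M N : nat) : Prop := exists P, P \in ribbon_tilings n M N.

Local Open Scope ring_scope.

Definition log2 {R : realType} (x : R) : R := ln x / ln 2.

Definition entropy {R : realType} (n M N : nat) : R :=
  log2 (#|ribbon_tilings n M N|%:R) / ((M * N)%:R / n%:R).

(* Main.v *)
(** A rectangle tiled by [n]-ribbons has a side divisible by [n], so the number
    T(M, N) of tilings is supermultiplicative under cutting either side, with
    only positive factors as soon as the pieces have a side divisible by [n].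
    Together with T(M, N) <= 4 ^ (M N), a two-dimensional Fekete argument shows
    that the entropy per ribbon tends to its supremum over all tileable
    rectangles.  This supremum is at least the entropy of the [n] x [n] square.
    There, for every permutation [s], exactly one tiling has, for each [p], the
    ribbon through the cell of row [p] on the main antidiagonal starting on the
    antidiagonal i + j = s p; hence T(n, n) >= n!, and Stirling's bound
    n! >= sqrt (2 pi n) (n / e) ^ n concludes. *)

Require Import Defs.
From mathcomp Require Import all_boot all_order all_algebra.
From mathcomp Require Import fingroup perm algC cyclotomic.
From mathcomp Require Import all_classical all_reals all_analysis.
From mathcomp Require Import zify ring lra.
Import Order.TTheory GRing.Theory Num.Theory.
Import numFieldNormedType.Exports.

Set Implicit Arguments.
Unset Strict Implicit.
Unset Printing Implicit Defensive.

(** * Ribbon tilings of rectangles *)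

Section RibbonTilings.
Import mathcomp.boot.finset.

(** * Ribbons and the antidiagonals they cross *)

Definition ribbon_step M N : rel (cell M N) :=
  fun c d => directly_above c d || directly_right c d.

Definition level M N (c : cell M N) : nat := c.1 + c.2.

Lemma level_step M N (c d : cell M N) : ribbon_step c d -> level d = (level c).+1.
Proof. by rewrite /level => /orP[] /andP[/eqP -> /eqP ->]; rewrite ?addSn ?addnS. Qed.

Lemma map_level_path M N (c : cell M N) s : path (@ribbon_step M N) c s ->
  map (@level M N) s = iota (level c).+1 (size s).
Proof.
by elim: s c => //= d s IH c /andP[/level_step lcd /IH ->]; rewrite lcd.
Qed.

Lemma is_ribbonP n M N (B : {set cell M N}) :
  reflect (exists s : seq (cell M N),
    [/\ size s = n, sorted (@ribbon_step M N) s & B = [set c in s]]) (is_ribbon n B).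
Proof.
apply: (iffP existsP) => [[s /andP[sorted_s /eqP ->]]|[s [<- sorted_s ->]]].
  by exists s; rewrite size_tuple.
by exists (in_tuple s); rewrite sorted_s eqxx.
Qed.

(** Each step raises the level by one, so a ribbon meets [n] consecutive antidiagonals once each;
    distinct levels also make its cells distinct. *)
Lemma ribbon_levels n M N (B : {set cell M N}) : is_ribbon n B ->
  exists s a, [/\ uniq s, B = [set c in s] & map (@level M N) s = iota a n].
Proof.
case/is_ribbonP => -[|c s] [<- /= ps ->]; first by exists [::], 0.
have e : map (@level M N) (c :: s) = iota (level c) (size s).+1.
  by rewrite /= (map_level_path ps).
exists (c :: s), (level c); split => //.
by apply: (@map_uniq _ _ (@level M N)); rewrite e iota_uniq.
Qed.

Lemma ribbon_tilingsP n M N (P : {set {set cell M N}}) :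
  reflect (partition P [set: cell M N] /\ {in P, forall B, is_ribbon n B})
    (P \in ribbon_tilings n M N).
Proof. by rewrite inE; apply: (iffP andP) => -[? /forall_inP]. Qed.

(** * Divisibility of a side, by roots of unity *)

Section Divisibility.
Local Open Scope ring_scope.

(** The weights form a geometric sum, which the factor [z - 1] turns into a multiple of
    [z ^+ n - 1]. This factor lets [n = 1] be included, where [z = 1] and the sum itself is
    nonzero. *)
Lemma ribbon_root_sum (R : comNzRingType) (z : R) n M N (B : {set cell M N}) :
  z ^+ n = 1 -> is_ribbon n B -> (z - 1) * \sum_(c in B) z ^+ level c = 0.
Proof.
move=> zn /ribbon_levels[s [a [us -> ls]]].
under eq_bigl do rewrite inE.
rewrite -big_uniq //= -(big_map (@level M N) xpredT (fun k => z ^+ k)) ls.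
have -> : \sum_(k <- iota a n) z ^+ k = z ^+ a * \sum_(k < n) z ^+ k.
  rewrite big_distrr -[X in iota X]addn0 iotaDl big_map /= -{1}[n]subn0 big_mkord.
  by apply: eq_bigr => i _; rewrite exprD.
by rewrite mulrCA -subrX1 zn subrr mulr0.
Qed.

(* Weighting the cell (i, j) by [z ^ (i + j)] for a primitive [n]th root of
   unity [z] makes every ribbon sum to zero. *)
Lemma tileable_dvd n M N : (0 < n)%N -> tileable n M N -> (n %| M)%N || (n %| N)%N.
Proof.
move=> n0 [P /ribbon_tilingsP[Ppart Prib]].
have [z zprim] := C_prim_root_exists n0.
have zn := prim_expr_order zprim.
have S0 : (z - 1) * \sum_(c : cell M N) z ^+ level c = 0.
  rewrite (eq_bigl (fun c => c \in [set: cell M N])); last by move=> c; rewrite inE.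
  rewrite (set_partition_big _ Ppart) big_distrr big1 //= => B PB.
  exact: ribbon_root_sum zn (Prib B PB).
have S1 : \sum_(c : cell M N) z ^+ level c =
    (\sum_(i < M) z ^+ i) * (\sum_(j < N) z ^+ j).
  rewrite big_distrlr /= pair_bigA /=.
  by apply: eq_bigr => c _; rewrite exprD.
(* The two divisibilities mean [z ^+ M = 1] and [z ^+ N = 1]; the product of [z ^+ M - 1] and
   [z ^+ N - 1] is [(z - 1) ^+ 2] times the total weight, hence zero. *)
rewrite !(prim_order_dvd zprim) -![z ^+ _ == 1]subr_eq0 -mulf_eq0 !subrX1.
by rewrite mulrACA -S1 -mulrA S0 mulr0.
Qed.

End Divisibility.

(** * An upper bound: two bits per cell *)

Lemma card_ribbon_tilings_le n M N : #|ribbon_tilings n M N| <= 4 ^ (M * N).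
Proof.
pose next (b : bool) := if b then @directly_above M N else @directly_right M N.
have next_inj b c d d' : next b c d -> next b c d' -> d = d'.
  case: d d' => [i j] [i' j']; rewrite /next.
  by case: b => /andP[/= /eqP a1 /eqP a2] /andP[/= /eqP b1 /eqP b2];
    congr pair; apply: val_inj; rewrite /= ?a1 ?b1 ?a2 ?b2.
(* A tiling is determined by recording, for every cell, whether the cell above
   it and the cell to its right belong to the same ribbon. *)
pose code (P : {set {set cell M N}}) : {ffun cell M N * bool -> bool} :=
  [ffun x => [exists d, next x.2 x.1 d && (d \in pblock P x.1)]].
have -> : 4 ^ (M * N) = #|{ffun cell M N * bool -> bool}|.
  by rewrite card_ffun !card_prod !card_bool !card_ord -[4]/(2 ^ 2) -expnM mulnC.
have step P Q c d : code P = code Q -> ribbon_step c d ->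
    d \in pblock P c -> d \in pblock Q c.
  move=> ePQ cd dP.
  have [b bcd] : exists b, next b c d.
    by case/orP: cd => ?; [exists true|exists false].
  have : code P (c, b) by rewrite ffunE; apply/existsP; exists d; rewrite bcd.
  rewrite ePQ ffunE => /existsP[d' /andP[/= bcd' d'Q]].
  by rewrite (next_inj b c d d').
have sub P Q : P \in ribbon_tilings n M N -> Q \in ribbon_tilings n M N ->
    code P = code Q -> forall c d, d \in pblock P c -> d \in pblock Q c.
  move=> /ribbon_tilingsP[/and3P[/eqP covP tiP _] ribP].
  move=> /ribbon_tilingsP[/and3P[/eqP covQ tiQ _] _] ePQ c d dP.
  have PB : pblock P c \in P by rewrite pblock_mem // covP inE.
  have cP : c \in pblock P c by rewrite mem_pblock covP inE.
  have /is_ribbonP[s [_ ss Bs]] := ribP _ PB.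
  have blockP x : x \in s -> pblock P x = pblock P c.
    by move=> xs; apply: same_pblock => //; rewrite Bs inE.
  (* The block of [P] is a ribbon; following it step by step, the equal codes keep all its cells in
     one block of [Q]. *)
  suff : {in s &, forall x y, pblock Q x = pblock Q y}.
    move: dP cP; rewrite Bs !inE => ds cs /(_ d c ds cs) <-.
    by rewrite mem_pblock covQ inE.
  case: s ss {Bs} blockP => // x s /= xs blockP.
  have {}blockP : {in x :: s, forall y, pblock P y = pblock P x}.
    by move=> y ys; rewrite !blockP // mem_head.
  suff H : {in x :: s, forall y, pblock Q y = pblock Q x}.
    by move=> y z ys zs; rewrite !H.
  elim: s x xs blockP => [x _ _ y|z s IH x /= /andP[xz zs] blockP y].
    by rewrite inE => /eqP ->.
  have zx : pblock P z = pblock P x.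
    by apply: blockP; rewrite !inE eqxx orbT.
  have Qzx : pblock Q z = pblock Q x.
    apply: same_pblock => //; apply: (step P) => //.
    by rewrite -zx mem_pblock covP inE.
  rewrite inE => /orP[/eqP -> //|ys].
  rewrite -Qzx; apply: IH => // t ts.
  by rewrite zx; apply: blockP; rewrite inE ts orbT.
have code_inj : {in ribbon_tilings n M N &, injective code}.
  move=> P Q TP TQ ePQ.
  have /ribbon_tilingsP[partP _] := TP; have /ribbon_tilingsP[partQ _] := TQ.
  (* A partition is recovered from its blocks [pblock], which have been shown to agree at every
     cell. *)
  rewrite -(preim_partition_pblock partP) -(preim_partition_pblock partQ).
  congr (preim_partition _ _); apply/funext => c; apply/setP => d.
  by apply/idP/idP; apply: sub.
by rewrite -(card_in_imset code_inj) max_card.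
Qed.

(** * Gluing tilings of smaller rectangles *)

Lemma is_ribbon_imset n M1 N1 M N (f : cell M1 N1 -> cell M N)
    (B : {set cell M1 N1}) :
  {homo f : c d / ribbon_step c d} -> is_ribbon n B -> is_ribbon n (f @: B).
Proof.
move=> fstep /is_ribbonP[s [<- ss ->]]; apply/is_ribbonP; exists (map f s).
split; rewrite ?size_map //; first exact: homo_sorted ss.
by apply/setP => c; rewrite inE; apply/imsetP/mapP => -[d];
  rewrite ?inE => ds ->; exists d; rewrite ?inE.
Qed.

(** The maps [f] and [g] place two rectangles side by side; the union of the two image tilings is a
    tiling from which both can be read off. *)
Lemma ribbon_tilings_glue n M1 N1 M2 N2 M N
    (f : cell M1 N1 -> cell M N) (g : cell M2 N2 -> cell M N) :
  injective f -> injective g -> (forall c d, f c != g d) ->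
  (forall e, (exists c, e = f c) \/ (exists d, e = g d)) ->
  {homo f : c d / ribbon_step c d} -> {homo g : c d / ribbon_step c d} ->
  #|ribbon_tilings n M1 N1| * #|ribbon_tilings n M2 N2| <= #|ribbon_tilings n M N|.
Proof.
move=> f_inj g_inj fg cov fstep gstep.
pose fI (P : {set {set cell M1 N1}}) := [set f @: (B : {set _}) | B in P].
pose gI (P : {set {set cell M2 N2}}) := [set g @: (B : {set _}) | B in P].
pose glue PQ := fI PQ.1 :|: gI PQ.2.
rewrite -cardsX -(card_in_imset (f := glue)).
  apply: subset_leq_card; apply/fintype.subsetP => _ /imsetP[[P Q] /setXP[/= TP TQ] ->].
  have /ribbon_tilingsP[partP ribP] := TP; have /ribbon_tilingsP[partQ ribQ] := TQ.
  apply/ribbon_tilingsP; split; last first.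
    by move=> _ /setUP[] /imsetP[B ? ->]; apply: is_ribbon_imset; auto.
  have /and3P[/eqP covf tif f0] : partition (fI P) (f @: [set: cell M1 N1]).
    by rewrite imset_partition.
  have /and3P[/eqP covg tig g0] : partition (gI Q) (g @: [set: cell M2 N2]).
    by rewrite imset_partition.
  apply/and3P; split.
  - rewrite /cover bigcup_setU -![\bigcup_(i in _) i]/(cover _) covf covg.
    apply/eqP/setP => e; rewrite !inE.
    by case: (cov e) => -[c ->]; rewrite imset_f ?inE ?orbT.
  - apply: trivIsetU => //; rewrite covf covg disjoint_subset.
    apply/fintype.subsetP => _ /imsetP[c _ ->]; rewrite inE.
    by apply/imsetP => -[d _ /eqP]; apply/negP.
  - by rewrite inE negb_or f0.
(* The ranges are disjoint, so only empty sets have a common image; as blocks are nonempty, each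
   block of the union reveals its side. *)
have fgB (B : {set cell M1 N1}) (C : {set cell M2 N2}) :
    f @: B = g @: C -> B = set0 /\ C = set0.
  move=> e; split; apply/setP => x; rewrite inE; apply/negP => xB.
    have : f x \in f @: B by rewrite imset_f.
    by rewrite e => /imsetP[d _ /eqP]; apply/negP.
  have : g x \in g @: C by rewrite imset_f.
  by rewrite -e => /imsetP[d _ /esym/eqP]; apply/negP.
have subf P Q P' Q' : P \in ribbon_tilings n M1 N1 -> glue (P, Q) = glue (P', Q') ->
    P \subset P'.
  move=> /ribbon_tilingsP[/and3P[_ _ P0] _] e; apply/fintype.subsetP => B PB.
  have : f @: B \in glue (P', Q') by rewrite -e inE imset_f.
  case/setUP => /imsetP[C C' eBC]; first by rewrite (imset_inj f_inj eBC).
  by move: PB P0; rewrite (fgB _ _ eBC).1 => ->.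
have subg P Q P' Q' : Q \in ribbon_tilings n M2 N2 -> glue (P, Q) = glue (P', Q') ->
    Q \subset Q'.
  move=> /ribbon_tilingsP[/and3P[_ _ P0] _] e; apply/fintype.subsetP => B PB.
  have : g @: B \in glue (P', Q') by rewrite -e inE imset_f ?orbT.
  case/setUP => /imsetP[C C' eBC]; last by rewrite (imset_inj g_inj eBC).
  by move: PB P0; rewrite (fgB _ _ (esym eBC)).2 => ->.
move=> [P Q] [P' Q'] /setXP[/= TP TQ] /setXP[/= TP' TQ'] e.
by congr pair; apply/eqP; rewrite eqEsubset;
  rewrite ?(subf _ _ _ _ TP e) ?(subf _ _ _ _ TP' (esym e))
    ?(subg _ _ _ _ TQ e) ?(subg _ _ _ _ TQ' (esym e)).
Qed.

Lemma ribbon_tilings_addl n M1 M2 N :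
  #|ribbon_tilings n M1 N| * #|ribbon_tilings n M2 N| <=
    #|ribbon_tilings n (M1 + M2) N|.
Proof.
pose f (c : cell M1 N) : cell (M1 + M2) N := (lshift M2 c.1, c.2).
pose g (c : cell M2 N) : cell (M1 + M2) N := (rshift M1 c.1, c.2).
apply: (@ribbon_tilings_glue _ _ _ _ _ _ _ f g).
- by move=> [i j] [i' j'] [] /val_inj -> ->.
- by move=> [i j] [i' j'] [] /eqP; rewrite eqn_add2l => /eqP /val_inj -> ->.
- by move=> [i j] [i' j']; rewrite xpair_eqE eq_lrshift.
- move=> [i j]; case: (split_ordP i) => k ->; [left|right]; by exists (k, j).
- by [].
- move=> c d; rewrite /ribbon_step /directly_above /directly_right /=.
  by rewrite -addnS !eqn_add2l.
Qed.

Lemma ribbon_tilings_addr n M N1 N2 :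
  #|ribbon_tilings n M N1| * #|ribbon_tilings n M N2| <=
    #|ribbon_tilings n M (N1 + N2)|.
Proof.
pose f (c : cell M N1) : cell M (N1 + N2) := (c.1, lshift N2 c.2).
pose g (c : cell M N2) : cell M (N1 + N2) := (c.1, rshift N1 c.2).
apply: (@ribbon_tilings_glue _ _ _ _ _ _ _ f g).
- by move=> [i j] [i' j'] [] -> /val_inj ->.
- by move=> [i j] [i' j'] [] -> /eqP; rewrite eqn_add2l => /eqP /val_inj ->.
- by move=> [i j] [i' j']; rewrite xpair_eqE eq_lrshift andbF.
- move=> [i j]; case: (split_ordP j) => k ->; [left|right]; by exists (i, k).
- by [].
- move=> c d; rewrite /ribbon_step /directly_above /directly_right /=.
  by rewrite -addnS !eqn_add2l.
Qed.

(** The empty tiling; it starts the inductions on the number of copies. *)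
Lemma ribbon_tilings_empty n M N : M * N = 0 -> 0 < #|ribbon_tilings n M N|.
Proof.
move=> MN0; apply/card_gt0P; exists set0; apply/ribbon_tilingsP; split.
  suff -> : [set: cell M N] = set0 by rewrite partition_set0.
  by apply/eqP; rewrite -cards_eq0 cardsT card_prod !card_ord MN0.
by move=> B; rewrite inE.
Qed.

Lemma ribbon_tilings_expl n k M N :
  #|ribbon_tilings n M N| ^ k <= #|ribbon_tilings n (k * M) N|.
Proof.
elim: k => [|k IH]; first by rewrite ribbon_tilings_empty.
rewrite expnS mulSn; apply: leq_trans (ribbon_tilings_addl _ _ _ _).
by rewrite leq_mul2l IH orbT.
Qed.

Lemma ribbon_tilings_expr n k M N :
  #|ribbon_tilings n M N| ^ k <= #|ribbon_tilings n M (k * N)|.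
Proof.
elim: k => [|k IH]; first by rewrite ribbon_tilings_empty ?muln0.
rewrite expnS mulSn; apply: leq_trans (ribbon_tilings_addr _ _ _ _).
by rewrite leq_mul2l IH orbT.
Qed.

(** * Tilings of rectangles with a side divisible by [n] *)

Lemma is_ribbon_ord n M N (f : 'I_n -> cell M N) :
  (forall i j : 'I_n, j = i.+1 :> nat -> ribbon_step (f i) (f j)) ->
  is_ribbon n [set f i | i in 'I_n].
Proof.
move=> fstep; apply/is_ribbonP; exists (codom f); split.
- by rewrite size_codom card_ord.
- rewrite sorted_map.
  apply: (@sub_sorted _ (relpre val (fun a b => b == a.+1))).
    by move=> i j /= /eqP; apply: fstep.
  rewrite -sorted_map val_enum_ord.
  case: n {f fstep} => //= n; move: 0.
  by elim: n => //= n IH k; rewrite eqxx IH.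
- by apply/setP => c; rewrite inE; apply/imsetP/codomP => -[i]; [exists i|exists i].
Qed.

Lemma ribbon_tilings_single n M N (f : 'I_n -> cell M N) : 0 < n ->
  (forall i j : 'I_n, j = i.+1 :> nat -> ribbon_step (f i) (f j)) ->
  (forall c, exists i, c = f i) -> 0 < #|ribbon_tilings n M N|.
Proof.
move=> n0 fstep fonto; apply/card_gt0P.
have eT : [set f i | i in 'I_n] = [set: cell M N].
  by apply/setP => c; rewrite inE; apply/imsetP; have [i ->] := fonto c; exists i.
exists [set [set: cell M N]]; apply/ribbon_tilingsP; split.
  rewrite /partition cover1 eqxx trivIset1 inE eq_sym -eT.
  by apply/set0Pn; exists (f (Ordinal n0)); rewrite imset_f.
by move=> B; rewrite inE => /eqP ->; rewrite -eT; apply: is_ribbon_ord.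
Qed.

(** Straight ribbons suffice: copies of the [n] by 1 or of the 1 by [n] rectangle fill the
    region. *)
Lemma dvd_ribbon_tilings n M N : 0 < n -> (n %| M) || (n %| N) ->
  0 < #|ribbon_tilings n M N|.
Proof.
move=> n0 /orP[] /dvdnP[k ->].
  apply: leq_trans (ribbon_tilings_expl _ _ _ _); rewrite expn_gt0; apply/orP; left.
  rewrite -[N]muln1; apply: leq_trans (ribbon_tilings_expr _ _ _ _).
  rewrite expn_gt0; apply/orP; left.
  apply: (@ribbon_tilings_single _ _ _ (fun i => (i, ord0))) => //.
    by move=> i j ij; rewrite /ribbon_step /directly_above /= ij eqxx.
  by move=> [i j]; exists i; rewrite (ord1 j).
apply: leq_trans (ribbon_tilings_expr _ _ _ _); rewrite expn_gt0; apply/orP; left.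
rewrite -[M]muln1; apply: leq_trans (ribbon_tilings_expl _ _ _ _).
rewrite expn_gt0; apply/orP; left.
apply: (@ribbon_tilings_single _ _ _ (fun i => (ord0, i))) => //.
  by move=> i j ij; rewrite /ribbon_step /directly_right /= ij !eqxx ?orbT.
by move=> [i j]; exists j; rewrite (ord1 i).
Qed.

(** * Tilings of the square from permutations *)

Section Square.
Variable m : nat.
Local Notation n := m.+1.
Implicit Types (s : {perm 'I_n}) (p q t : 'I_n) (v : nat).

(* In the tiling attached to [s], the ribbon through the cell of row [p] on the
   main antidiagonal starts on the antidiagonal [i + j = s p]; [coord ltn s p v]
   and [coord gtn s p v] are the row and the column of its cell with
   [i + j = v].  A ribbon [q < p] that starts, or a ribbon [q > p] that ends,
   pushes the ribbon of [p] up by one row. *)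
Definition coord (lt : rel nat) s p v : nat :=
  \sum_(q < n) ((lt q p && (s q <= v)) + (lt p q && (s q + n <= v))).

Lemma sum_leq_ord k a v : \sum_(i < k) (i + a <= v) = minn k (v.+1 - a).
Proof.
elim: k => [|k IH]; first by rewrite big_ord0 min0n.
by rewrite big_ord_recr /= IH; case: leqP; lia.
Qed.

(** Spreads a 1 over the ribbons, so that strict or shifted comparisons can be made term by term. *)
Lemma sum_eq_ord p : \sum_(q < n) (q == p :> nat) = 1.
Proof.
rewrite (bigD1 p) //= eqxx big1 // => q.
by rewrite -val_eqE => /negPf ->.
Qed.

(** With one added for [p] itself, the left side counts the ribbons started plus those ended by
    antidiagonal [v]. Since [s] is a permutation, this is [minn n v.+1 + (v.+1 - n)], that is
    [v.+1]. *)
Lemma coord_sum s p v : s p <= v < s p + n ->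
  coord ltn s p v + coord gtn s p v = v.
Proof.
move=> /andP[v1 v2].
have sp := ltn_ord (s p).
apply/eqP; rewrite -(eqn_add2r 1) -{1}(sum_eq_ord p); apply/eqP; rewrite addn1.
transitivity (\sum_(q < n) ((s q + 0 <= v) + (s q + n <= v))).
  rewrite /coord -!big_split /=; apply: eq_bigr => q _; rewrite addn0.
  by case: (ltngtP q p) => [||/val_inj ->] /=; lia.
rewrite (reindex_inj (@perm_inj _ (s^-1)%g)) /=.
under eq_bigr do rewrite permKV.
by rewrite big_split /= !sum_leq_ord; lia.
Qed.

(** By asymmetry each [q] other than [p] contributes at most one, and [p] contributes nothing. *)
Lemma coord_lt (lt : rel nat) s p v : irreflexive lt ->
  (forall a b, lt a b -> ~~ lt b a) -> coord lt s p v < n.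
Proof.
move=> irr asym; rewrite -[X in X <= _]addn1 -{1}(sum_eq_ord p).
rewrite /coord -big_split /= -[leqRHS](card_ord n) -sum1_card; apply: leq_sum => q _.
case: eqP => [->|_]; first by rewrite irr.
by have := asym q p; case: (lt q p); case: (lt p q) => /= H; try lia; have := H isT.
Qed.

Lemma coord_mono lt s p v w : v <= w -> coord lt s p v <= coord lt s p w.
Proof. by move=> vw; apply: leq_sum => q _; case: (lt q p); case: (lt p q); lia. Qed.

(** This orders the ribbons along an antidiagonal and so keeps them disjoint. The strict gain comes
    from the term [r = p]: ribbon [p] has started and pushes [q] up. *)
Lemma coord_homo s p q v : s p <= v < s p + n -> s q <= v < s q + n ->
  p < q -> coord ltn s p v < coord ltn s q v.
Proof.
move=> pv qv pq; rewrite -addn1 -(sum_eq_ord p) /coord -big_split /=.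
apply: leq_sum => r _.
have ep : r = p :> nat -> s r = s p :> nat by move/val_inj ->.
have eq : r = q :> nat -> s r = s q :> nat by move/val_inj ->.
by case: (ltngtP r p) ep => rp ep; case: (ltngtP r q) eq => rq eq /=; lia.
Qed.

Definition perm_cell s p t : cell n n :=
  (inord (coord ltn s p (s p + t)), inord (coord gtn s p (s p + t))).

Lemma perm_cell_row s p t : (perm_cell s p t).1 = coord ltn s p (s p + t) :> nat.
Proof. by rewrite inordK // coord_lt // => a b; rewrite -leqNgt => /ltnW. Qed.

Lemma perm_cell_col s p t : (perm_cell s p t).2 = coord gtn s p (s p + t) :> nat.
Proof. by rewrite inordK // coord_lt // => [a|a b] /=; lia. Qed.

Lemma level_perm_cell s p t : level (perm_cell s p t) = s p + t.
Proof.
by rewrite /level perm_cell_row perm_cell_col coord_sum // leq_addr ltn_add2l /=.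
Qed.

Lemma perm_cell_inj s : injective (fun pt : 'I_n * 'I_n => perm_cell s pt.1 pt.2).
Proof.
suff H p q t u : perm_cell s p t = perm_cell s q u -> ~~ (p < q).
  move=> [p t] [q u] /= e.
  have pq : p = q.
    apply: val_inj; have := H _ _ _ _ e; have := H _ _ _ _ (esym e).
    by case: ltngtP.
  congr pair => //; apply: val_inj; apply/eqP; rewrite -(eqn_add2l (s p)).
  by rewrite -level_perm_cell e level_perm_cell pq.
move=> e; have lev := level_perm_cell s p t; rewrite e level_perm_cell in lev.
have := perm_cell_row s p t; rewrite e perm_cell_row lev => er.
apply/negP => pq.
have := @coord_homo s p q (s p + t); rewrite er ltnn => H.
suff: false by []; apply: H pq; last rewrite -lev;
  by rewrite leq_addr ltn_add2l ltn_ord.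
Qed.

Definition perm_ribbon s p : {set cell n n} := [set perm_cell s p t | t in 'I_n].

Definition perm_tiling s : {set {set cell n n}} := [set perm_ribbon s p | p in 'I_n].

(** The level rises by one and neither coordinate decreases, so exactly one coordinate rises, by
    one. *)
Lemma perm_cell_step s p t (u : 'I_n) : u = t.+1 :> nat ->
  ribbon_step (perm_cell s p t) (perm_cell s p u).
Proof.
move=> ut.
have := level_perm_cell s p t; have := level_perm_cell s p u.
rewrite /level /ribbon_step /directly_above /directly_right.
rewrite !perm_cell_row !perm_cell_col ut.
have le : s p + t <= s p + t.+1 by rewrite leq_add2l.
have := coord_mono ltn s p le; have := coord_mono gtn s p le.
move: (coord _ _ _ _) (coord _ _ _ _) (coord _ _ _ _) (coord _ _ _ _); lia.
Qed.

Lemma perm_ribbon_disjoint s p q : p != q ->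
  [disjoint perm_ribbon s p & perm_ribbon s q].
Proof.
move=> pq; rewrite disjoint_subset; apply/fintype.subsetP => _ /imsetP[t _ ->].
rewrite inE; apply/imsetP => -[u _ e].
by have [epq _] := @perm_cell_inj s (p, t) (q, u) e; rewrite epq eqxx in pq.
Qed.

Lemma perm_tilingP s : perm_tiling s \in ribbon_tilings n n n.
Proof.
apply/ribbon_tilingsP; split; last first.
  by move=> _ /imsetP[p _ ->]; apply: is_ribbon_ord => i j; apply: perm_cell_step.
have [part _] : partition (perm_tiling s) (cover (perm_tiling s)) /\
    {in 'I_n &, injective (perm_ribbon s)}.
  apply: indexed_partition => [p q _ _|p _].
    by rewrite eq_sym; apply: perm_ribbon_disjoint.
  by apply/set0Pn; exists (perm_cell s p ord0); rewrite imset_f.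
rewrite (_ : [set: _] = cover (perm_tiling s)) //.
apply/setP => c; rewrite inE; apply/esym/bigcupP.
(* The pairs are as many as the cells, so injectivity already gives the covering. *)
have /codomP[[p t] ->] : c \in codom (fun pt : 'I_n * 'I_n => perm_cell s pt.1 pt.2).
  exact: inj_card_onto (@perm_cell_inj s) _ c.
by exists (perm_ribbon s p); rewrite imset_f.
Qed.

(** On the main antidiagonal every ribbon has started and none has ended, so the row counts the
    [q < p], whatever [s] is. *)
Lemma coord_diag s p : coord ltn s p m = p.
Proof.
transitivity (\sum_(q < n) (q + 1 <= p)).
  apply: eq_bigr => q _; have := ltn_ord (s q); lia.
by rewrite sum_leq_ord; have := ltn_ord p; lia.
Qed.

Lemma perm_tiling_inj : injective perm_tiling.
Proof.
suff le s s' : perm_tiling s = perm_tiling s' -> forall p, s' p <= s p.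
  move=> s s' e; apply/permP => p; apply: val_inj; apply/eqP.
  by rewrite eqn_leq !le.
move=> e p.
(* The position along ribbon [p] of its cell on the main antidiagonal; that cell is the same for [s]
   and [s'], so both ribbons coincide. *)
pose t s : 'I_n := inord (m - s p).
have st s0 : s0 p + t s0 = m.
  by have := ltn_ord (s0 p); rewrite inordK; lia.
have diag : perm_cell s p (t s) = perm_cell s' p (t s').
  have row s0 : (perm_cell s0 p (t s0)).1 = p :> nat.
    by rewrite perm_cell_row st coord_diag.
  have col s0 : (perm_cell s0 p (t s0)).2 = m - p :> nat.
    by have := level_perm_cell s0 p (t s0); rewrite st /level row; lia.
  by rewrite [LHS]surjective_pairing [RHS]surjective_pairing;
    congr pair; apply: val_inj; rewrite /= ?row ?col.
have /ribbon_tilingsP[/and3P[_ tiP _] _] := perm_tilingP s.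
have eR : perm_ribbon s p = perm_ribbon s' p.
  rewrite -(def_pblock tiP (_ : perm_ribbon s p \in _)
    (imset_f _ (_ : t s \in _))) ?imset_f //.
  rewrite diag; apply: def_pblock => //; last by rewrite imset_f.
  by rewrite e imset_f.
(* The first cell, of level [s p], lies in a ribbon whose levels are at least [s' p]. *)
have : perm_cell s p ord0 \in perm_ribbon s' p by rewrite -eR imset_f.
case/imsetP => u _ /(congr1 (@level _ _)).
by rewrite !level_perm_cell addn0 => ->; rewrite leq_addr.
Qed.

End Square.

Lemma fact_le_ribbon_tilings n : n`! <= #|ribbon_tilings n n n|.
Proof.
case: n => [|m]; first by rewrite ribbon_tilings_empty.
rewrite -card_Sn -(card_imset _ (@perm_tiling_inj m)).
apply: subset_leq_card; apply/fintype.subsetP => _ /imsetP[s _ ->].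
exact: perm_tilingP.
Qed.

(** * Cutting a large rectangle into equal blocks *)

Lemma tileableP n M N : tileable n M N <-> 0 < #|ribbon_tilings n M N|.
Proof. by split=> [[P TP]|/card_gt0P[P TP]]; [apply/card_gt0P|]; exists P. Qed.

Lemma ribbon_tilings_blocks n A B M N : 0 < n -> n %| A -> n %| B ->
  tileable n M N ->
  #|ribbon_tilings n A B| ^ ((M %/ A) * (N %/ B)) <= #|ribbon_tilings n M N|.
Proof.
move=> n0 nA nB /(tileable_dvd n0) tMN.
pose T a b := #|ribbon_tilings n a b|.
rewrite -[leqLHS]/(T A B ^ _) -[leqRHS]/(T M N).
have pos a b : (n %| a) || (n %| b) -> 0 < T a b := @dvd_ribbon_tilings n a b n0.
have addl a b c : T a c * T b c <= T (a + b) c := ribbon_tilings_addl n a b c.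
have addr a b c : T a b * T a c <= T a (b + c) := ribbon_tilings_addr n a b c.
have expl k a b : T a b ^ k <= T (k * a) b := ribbon_tilings_expl n k a b.
have expr k a b : T a b ^ k <= T a (k * b) := ribbon_tilings_expr n k a b.
clearbody T.
have eM := divn_eq M A; have eN := divn_eq N B.
set q := M %/ A in eM *; set p := N %/ B in eN *.
apply: leq_trans (_ : T (q * A) (p * B) <= _).
  rewrite mulnC expnM; apply: leq_trans (expl _ _ _).
  by case: (q) => // k; rewrite leq_exp2r.
(* The order of the two cuts depends on the side that [n] divides, so that both leftover strips have
   a side divisible by [n] and are tileable. *)
case/orP: tMN => [nM|nN].
  apply: leq_trans (_ : T (q * A) N <= _).
    rewrite eN; apply: leq_trans (addr _ _ _).
    by rewrite leq_pmulr // pos // dvdn_mull.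
  rewrite eM; apply: leq_trans (addl _ _ _).
  by rewrite leq_pmulr // pos // /dvdn (modn_dvdm _ nA) -/(dvdn _ _) nM.
apply: leq_trans (_ : T M (p * B) <= _).
  rewrite eM; apply: leq_trans (addl _ _ _).
  by rewrite leq_pmulr // pos // dvdn_mull // orbT.
rewrite eN; apply: leq_trans (addr _ _ _).
by rewrite leq_pmulr // pos // /dvdn (modn_dvdm _ nB) -![_ %% n == 0]/(dvdn _ _) nN
  orbT.
Qed.

End RibbonTilings.

Local Open Scope classical_set_scope.
Local Open Scope ring_scope.

(** * Stirling's lower bound *)

Section Stirling.
Context {R : realType}.

Lemma le_of_is_derive_ge0 (f df : R -> R) (a b : R) : a <= b ->
  (forall x, a <= x <= b -> is_derive x 1 f (df x)) ->
  (forall x, a <= x <= b -> 0 <= df x) -> f a <= f b.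
Proof.
move=> ab fd df0.
have [||c + E] := @MVT_segment R f df a b ab.
- by move=> x; rewrite in_itv /= => /andP[/ltW ax /ltW xb]; apply: fd; rewrite ax xb.
- apply: derivable_within_continuous => x; rewrite in_itv /= => xab.
  by have [] := fd x xab.
rewrite in_itv /= => cab.
by rewrite -subr_ge0 E mulr_ge0 ?df0 // subr_ge0.
Qed.

(** With [y = expR u] this is [u <= sinh u]; the difference has derivative [(1 - x^-1) ^+ 2 / 2]. *)
Lemma ln_le_sinh (y : R) : 1 <= y -> ln y <= (y - y^-1) / 2.
Proof.
move=> y1; pose f (x : R) := (x - x^-1) / 2 - ln x.
suff: f 1 <= f y by rewrite /f ln1 invr1 !subrr mul0r subr0 subr_ge0.
apply: (@le_of_is_derive_ge0 f (fun x => (1 + x^-2) / 2 - x^-1)) => // x /andP[x1 _].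
- have x0 : 0 < x by apply: lt_le_trans x1.
  have xn0 : x != 0 by rewrite gt_eqF.
  have dl := is_derive1_ln x0.
  have dv := is_deriveV xn0 (is_derive_id x 1).
  by rewrite /f; apply: is_derive_eq; rewrite /GRing.scale /=; field.
- have -> : (1 + x^-2) / 2 - x^-1 = (1 - x^-1) ^+ 2 / 2 by field; lra.
  by rewrite divr_ge0 ?sqr_ge0.
Qed.

(** * Wallis integrals, from primitives given by the reduction formula *)

Fixpoint sin_pow_primitive (m : nat) (x : R) : R :=
  match m with
  | 0 => x
  | 1 => - cos x
  | (k.+1 as k1).+1 =>
      (k1%:R * sin_pow_primitive k x - cos x * sin x ^+ k1) / k1.+1%:R
  end.

Lemma sin_pow_primitiveSS m x : sin_pow_primitive m.+2 x =
  (m.+1%:R * sin_pow_primitive m x - cos x * sin x ^+ m.+1) / m.+2%:R.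
Proof. by []. Qed.

Lemma is_derive_sin_pow_primitive m (x : R) :
  is_derive x 1 (sin_pow_primitive m) (sin x ^+ m).
Proof.
suff: is_derive x 1 (sin_pow_primitive m) (sin x ^+ m) /\
      is_derive x 1 (sin_pow_primitive m.+1) (sin x ^+ m.+1) by case.
elim: m => [|m [IH IH1]].
  split; first exact: is_derive_id.
  by apply: is_derive_eq; rewrite opprK expr1.
split; first exact: IH1.
have -> : sin_pow_primitive m.+2 = m.+2%:R^-1 \*:
    (m.+1%:R \*: sin_pow_primitive m - cos * sin ^+ m.+1 : R -> R).
  by apply/funext => y; rewrite sin_pow_primitiveSS mulrC !fctE.
apply: is_derive_eq; rewrite /GRing.scale /= fctE.
have -> : cos x * (m.+1%:R * sin x ^+ m * cos x) =
    m.+1%:R * sin x ^+ m * (1 - sin x ^+ 2) by rewrite -cos2sin2; ring.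
have : (m.+2%:R : R) != 0 by rewrite pnatr_eq0.
rewrite !exprS expr0 (_ : m.+2%:R = m.+1%:R + 1 :> R); last by rewrite -[in LHS]natr1.
by move=> ?; field.
Qed.

(* The integral of [sin ^+ m] over [0, pi / 2]. *)
Definition wallis m : R := sin_pow_primitive m (pi / 2) - sin_pow_primitive m 0.

Lemma wallis0 : wallis 0 = pi / 2.
Proof. by rewrite /wallis subr0. Qed.

Lemma wallis1 : wallis 1 = 1.
Proof. by rewrite /wallis /= cos_pihalf cos0; ring. Qed.

Lemma wallisSS m : wallis m.+2 = m.+1%:R / m.+2%:R * wallis m.
Proof.
by rewrite /wallis !sin_pow_primitiveSS cos_pihalf sin0 expr0n /=; ring.
Qed.

Lemma wallis_ge0 m : 0 <= wallis m.
Proof.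
suff: 0 <= wallis m /\ 0 <= wallis m.+1 by case.
elim: m => [|m [IH IH1]].
  by rewrite wallis0 wallis1 divr_ge0 ?pi_ge0.
by split=> //; rewrite wallisSS mulr_ge0 ?divr_ge0.
Qed.

Lemma wallisS_le m : wallis m.+1 <= wallis m.
Proof.
rewrite -subr_ge0.
pose f (x : R) := sin_pow_primitive m x - sin_pow_primitive m.+1 x.
suff: f 0 <= f (pi / 2) by rewrite /f /wallis; lra.
apply: (@le_of_is_derive_ge0 f (fun x => sin x ^+ m - sin x ^+ m.+1)).
- by rewrite divr_ge0 ?pi_ge0.
- move=> x _; have := is_derive_sin_pow_primitive m x.
  by have := is_derive_sin_pow_primitive m.+1 x => *; apply: is_derive_eq.
- move=> x /andP[x0 x1]; rewrite exprS -{1}[_ ^+ m]mul1r -mulrBl.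
  have s0 : 0 <= sin x by apply: sin_ge0_pi; have := pi_ge0 R; lra.
  by rewrite mulr_ge0 ?exprn_ge0 ?subr_ge0 ?sin_le1.
Qed.

(** The recurrence makes [m.+1%:R * wallis m * wallis m.+1] independent of [m]. *)
Lemma wallis_mulS m : wallis m * wallis m.+1 = pi / (2 * m.+1%:R).
Proof.
elim: m => [|m IH]; first by rewrite wallis0 wallis1 !mulr1.
rewrite wallisSS mulrCA [wallis m.+1 * _]mulrC IH.
have : (m.+1%:R : R) != 0 by rewrite pnatr_eq0.
have : (m.+2%:R : R) != 0 by rewrite pnatr_eq0.
by move=> ? ?; field; apply/andP.
Qed.

Lemma wallis_double m :
  wallis m.*2 * (m`!%:R ^+ 2 * 4 ^+ m) = pi / 2 * (m.*2)`!%:R.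
Proof.
elim: m => [|m IH]; first by rewrite wallis0 expr0 expr1n !mulr1.
rewrite doubleS wallisSS !factS !natrM.
have -> : m.*2.+1%:R / m.*2.+2%:R * wallis m.*2 *
    ((m.+1%:R * m`!%:R) ^+ 2 * 4 ^+ m.+1) =
    m.*2.+1%:R / m.*2.+2%:R * (m.+1%:R ^+ 2 * 4) *
    (wallis m.*2 * (m`!%:R ^+ 2 * 4 ^+ m)) :> R by rewrite [4 ^+ m.+1]exprS; ring.
have e : m.*2.+2%:R = 2 * m.+1%:R :> R by rewrite -doubleS -mul2n natrM.
rewrite IH e.
have : (m.+1%:R : R) != 0 by rewrite pnatr_eq0.
by move=> ?; field.
Qed.

(** The bound [4 ^ m / sqrt (pi m)] on the central binomial coefficient, squared and cleared of
    denominators. It comes from [wallis (2 m) ^ 2 <= wallis (2 m - 1) * wallis (2 m) = pi / (4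
    m)]. *)
Lemma central_binomial_le m : (0 < m)%N ->
  pi * m%:R * (m.*2)`!%:R ^+ 2 <= (m`!%:R ^+ 2 * 4 ^+ m) ^+ 2 :> R.
Proof.
case: m => // m _.
have := wallis_double m.+1; set a : R := _ ^+ 2 * _; set b : R := _`!%:R => ab.
have W : wallis m.+1.*2 ^+ 2 <= pi / (4 * m.+1%:R).
  have -> : (pi / (4 * m.+1%:R) : R) = wallis m.*2.+1 * wallis m.+1.*2.
    by rewrite doubleS wallis_mulS -doubleS -mul2n natrM; congr (_ / _); ring.
  by rewrite expr2 ler_wpM2r ?wallis_ge0 // doubleS wallisS_le.
have a0 : 0 <= a ^+ 2 by apply: sqr_ge0.
have := ler_wpM2r a0 W; rewrite -exprMn ab => H.
have m0 : 0 < m.+1%:R :> R by rewrite ltr0n.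
have p0 : 0 < pi :> R := pi_gt0 R.
move: m0 p0 H; move: (m.+1%:R : R) (pi : R) => x p x0 p0 H.
have := ler_wpM2l (ltW (divr_gt0 (mulr_gt0 (ltr0n R 4) x0) p0)) H.
have -> : 4 * x / p * (p / 2 * b) ^+ 2 = p * x * b ^+ 2.
  by field; rewrite gt_eqF.
suff -> : 4 * x / p * (p / (4 * x) * a ^+ 2) = a ^+ 2 by [].
by field; rewrite !gt_eqF.
Qed.

(** The logarithm of [n! e^n / n^(n + 1/2)], the classical sequence with limit
    [ln (sqrt (2 pi))]. *)
Definition stirling_log n : R := ln n`!%:R - (n%:R + 2^-1) * ln n%:R + n%:R.

Lemma stirling_log_ge0 n : (0 < n)%N -> 0 <= stirling_log n.
Proof.
case: n => // n _.
(* The strengthening telescopes: one step lowers [stirling_log] by at most the decrease of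
   [1 / (4 n)], and equality holds at index 1. *)
suff : 3 / 4 + (4 * n.+1%:R)^-1 <= stirling_log n.+1.
  apply: le_trans; rewrite addr_ge0 ?invr_ge0 ?mulr_ge0 ?divr_ge0 //.
elim: n => [|n IH].
  by rewrite /stirling_log factE /= ln1 !mulr1; lra.
apply: le_trans (_ : stirling_log n.+1 + (4 * n.+2%:R)^-1 - (4 * n.+1%:R)^-1 <= _).
  by rewrite lerBrDr addrAC lerD2r.
rewrite /stirling_log [n.+2`!]factS natrM lnM ?posrE ?ltr0n ?fact_gt0 //.
have e : n.+2%:R = n.+1%:R + 1 :> R by rewrite -natr1.
have x0 : 0 < n.+1%:R :> R by rewrite ltr0n.
rewrite e; set x : R := n.+1%:R in x0 *.
have : ln ((x + 1) / x) <= ((x + 1) / x - ((x + 1) / x)^-1) / 2.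
  by apply: ln_le_sinh; rewrite ler_pdivlMr //; lra.
rewrite ln_div ?posrE //; last by lra.
move=> /(ler_wpM2l (_ : 0 <= x + 2^-1)) H.
have {}H : (x + 2^-1) * (ln (x + 1) - ln x) <= 1 + (4 * x)^-1 - (4 * (x + 1))^-1.
  apply: le_trans (H _) _; first by lra.
  rewrite le_eqVlt; apply/orP; left; apply/eqP; field; lra.
by move: H; set c := (4 * x)^-1; set d := (4 * (x + 1))^-1; lra.
Qed.

(** The logarithm of the central binomial bound; the linear terms and those in [ln m] cancel. *)
Lemma stirling_log_double m : (0 < m)%N ->
  ln (Num.sqrt (2 * pi)) <= 2 * stirling_log m - stirling_log m.*2.
Proof.
move=> m0.
have mR : 0 < m%:R :> R by rewrite ltr0n.
have p0 : 0 < pi :> R := pi_gt0 R.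
have f0 k : 0 < k`!%:R :> R by rewrite ltr0n fact_gt0.
have -> : ln (Num.sqrt (2 * pi)) = (ln 2 + ln pi) / 2 :> R.
  rewrite -lnM ?posrE // -[in RHS](@sqr_sqrtr _ (2 * pi)) ?mulr_ge0 ?ltW //.
  by rewrite lnXn ?sqrtr_gt0 ?mulr_gt0 // -[ln _ *+ 2]mulr_natr mulfK.
have := central_binomial_le m0.
rewrite -ler_ln ?posrE ?exprn_gt0 ?mulr_gt0 ?exprn_gt0 //.
rewrite lnXn ?mulr_gt0 ?exprn_gt0 //.
rewrite !lnM ?posrE ?mulr_gt0 ?exprn_gt0 //.
rewrite !lnXn //.
have -> : ln 4 = 2 * ln 2 :> R.
  have -> : 4 = 2 ^+ 2 :> R by rewrite -natrX.
  by rewrite lnXn // mulr_natl.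
have e2 : m.*2%:R = 2 * m%:R :> R by rewrite -mul2n natrM.
rewrite /stirling_log e2 lnM ?posrE // -[_ *+ 2]mulr_natr -[2 * _ *+ m]mulr_natr.
have aux (a b c d e f : R) : c + b + (e + e) <= (d + d + 2 * a * f) * 2 ->
    (a + c) / 2 <= 2 * (d - (f + 2^-1) * b + f) -
      (e - (2 * f + 2^-1) * (a + b) + 2 * f) by lra.
apply aux.
Qed.

(* Doubling the index halves the defect [b n - s], which is bounded below. *)
Lemma ge_of_doubling (b : nat -> R) (s : R) :
  (forall n, (0 < n)%N -> 0 <= b n) ->
  (forall n, (0 < n)%N -> s <= 2 * b n - b n.*2) ->
  forall n, (0 < n)%N -> s <= b n.
Proof.
move=> b0 bs n n0.
have step k m : (0 < m)%N -> - s <= (b m - s) * 2 ^+ k.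
  elim: k m => [|k IH] m m0.
    by rewrite mulr1 lerDr b0.
  have m20 : (0 < m.*2)%N by rewrite double_gt0.
  apply: le_trans (IH _ m20) _; rewrite exprS mulrA ler_wpM2r ?exprn_ge0 //.
  by have := bs m m0; lra.
rewrite leNgt; apply/negP => lt.
have d0 : 0 < s - b n by rewrite subr_gt0.
(* The exponent is large enough for the negative defect, multiplied by this power of 2, to fall
   below [- s]. *)
have := upper_nthrootP (leqnn (Num.bound (s / (s - b n)))).
rewrite ltr_pdivrMr //; apply/negP; rewrite -leNgt.
by have := step (Num.bound (s / (s - b n))) n n0; lra.
Qed.

Lemma ln_sqrt_2pi_le_stirling_log n : (0 < n)%N ->
  ln (Num.sqrt (2 * pi)) <= stirling_log n.
Proof. exact: ge_of_doubling stirling_log_ge0 stirling_log_double n. Qed.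

End Stirling.

(** * Convergence of the entropy *)

Lemma entropyE (R : realType) n M N :
  entropy n M N = n%:R / ln 2 * (ln #|ribbon_tilings n M N|%:R / (M * N)%:R) :> R.
Proof. by rewrite /entropy /log2 invf_div; ring. Qed.

Lemma entropy_ge0 (R : realType) n M N : 0 <= entropy n M N :> R.
Proof.
have l2 : 0 <= ln 2 :> R by rewrite ln_ge0 // ler1n.
have lT : 0 <= ln #|ribbon_tilings n M N|%:R :> R.
  case: (posnP #|ribbon_tilings n M N|) => [->|T0]; first by rewrite ln0.
  by rewrite ln_ge0 // ler1n.
by rewrite entropyE mulr_ge0 ?divr_ge0.
Qed.

(** Two bits per cell and [n] cells per ribbon. Degenerate cases rest on the conventions [ln 0 = 0]
    and [0^-1 = 0]. *)
Lemma entropy_le (R : realType) n M N : entropy n M N <= 2 * n%:R :> R.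
Proof.
have l2 : 0 < ln 2 :> R by rewrite ln_gt0 // ltr1n.
have lnT : ln #|ribbon_tilings n M N|%:R <= (M * N)%:R * (2 * ln 2) :> R.
  case: (posnP #|ribbon_tilings n M N|) => [->|T0].
    by rewrite ln0 // !mulr_ge0 // ltW.
  have := card_ribbon_tilings_le n M N.
  move: (#|_|) T0 => T T0; rewrite -(ler_nat R) => TS.
  apply: le_trans (_ : ln ((4 ^ (M * N))%:R) <= _).
    by rewrite ler_ln ?posrE ?ltr0n ?expn_gt0.
  rewrite -[4%N]/(2 ^ 2)%N -expnM natrX lnXn // -mulr_natl natrM; lra.
rewrite entropyE.
case: (posnP (M * N)) => [->|MN0]; first by rewrite invr0 !mulr0 mulr_ge0.
have MN : 0 < (M * N)%:R :> R by rewrite ltr0n.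
have H : ln #|ribbon_tilings n M N|%:R / (M * N)%:R <= 2 * ln 2 :> R.
  by rewrite ler_pdivrMr // mulrC.
have -> : 2 * n%:R = n%:R / ln 2 * (2 * ln 2) :> R by field; rewrite gt_eqF.
by rewrite ler_wpM2l // divr_ge0 // ltW.
Qed.

Lemma ln_natr_le (R : realType) (a b : nat) : (0 < a)%N -> (a <= b)%N ->
  ln a%:R <= ln b%:R :> R.
Proof.
move=> a0 ab; rewrite ler_ln ?posrE ?ltr0n ?ler_nat //.
exact: leq_trans ab.
Qed.

(** Supermultiplicativity over [n * n] copies. Scaling makes both sides divisible by [n], as the
    block count requires. *)
Lemma entropy_scale (R : realType) n a b : (0 < n)%N -> tileable n a b ->
  entropy n a b <= entropy n (n * a) (n * b) :> R.
Proof.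
move=> n0 /tileableP T0.
have TT : (#|ribbon_tilings n a b| ^ (n * n) <=
    #|ribbon_tilings n (n * a) (n * b)|)%N.
  rewrite expnM; apply: leq_trans (ribbon_tilings_expr _ _ _ _).
  by rewrite leq_exp2r // ribbon_tilings_expl.
rewrite !entropyE.
have l2 : 0 < ln 2 :> R by rewrite ln_gt0 // ltr1n.
rewrite ler_wpM2l ?divr_ge0 ?(ltW l2) //.
move: T0 TT; move: #|_| #|_| => S T T0 TT.
case: (posnP (a * b)) => [ab0|ab0].
  by rewrite mulnACA ab0 muln0 !invr0 !mulr0.
have ab : 0 < (a * b)%:R :> R by rewrite ltr0n.
have nn : 0 < (n * n)%:R :> R by rewrite ltr0n muln_gt0 n0.
rewrite mulnACA (natrM _ (n * n)) invfM mulrA ler_pM2r ?invr_gt0 //.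
rewrite ler_pdivlMr //.
have Tk : (0 < T ^ (n * n))%N by rewrite expn_gt0 T0.
by have := ln_natr_le R Tk TT; rewrite natrX lnXn ?ltr0n // mulr_natr.
Qed.

(** Blocks fill at least a proportion [1 - d] of each side, hence [1 - 2 * d] of the area; since the
    entropy is at most [2 * n], the loss is at most [4 * n * d]. *)
Lemma entropy_ge_blocks (R : realType) n A B M N (d : R) :
  (0 < n)%N -> (0 < A)%N -> (0 < B)%N -> (n %| A)%N -> (n %| B)%N ->
  (0 < M)%N -> (0 < N)%N -> tileable n M N ->
  A%:R <= d * M%:R -> B%:R <= d * N%:R ->
  entropy n A B - 4 * n%:R * d <= entropy n M N.
Proof.
move=> n0 A0 B0 nA nB M0 N0 tMN AM BN.
have [gap0 le2n] := (entropy_ge0 R n A B, entropy_le R n A B).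
have fill (x y : nat) : (0 < x)%N -> (0 < y)%N -> x%:R <= d * y%:R ->
    1 - d <= ((y %/ x * x)%:R / y%:R : R) <= 1.
  move=> x0 y0 xy.
  have yR : 0 < y%:R :> R by rewrite ltr0n.
  rewrite ler_pdivlMr // ler_pdivrMr // mul1r ler_nat leq_trunc_div andbT.
  have : (y <= y %/ x * x + x)%N.
    by rewrite {1}(divn_eq y x) leq_add2l ltnW // ltn_mod.
  by rewrite -(ler_nat R) natrD; lra.
have d0 : 0 <= d.
  have : 0 < d * M%:R by apply: lt_le_trans AM; rewrite ltr0n.
  by rewrite pmulr_lgt0 ?ltr0n // => /ltW.
have /andP[x1 x2] := fill A M A0 M0 AM; have /andP[y1 y2] := fill B N B0 N0 BN.
set x := _ / _ in x1 x2; set y := _ / _ in y1 y2.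
apply: le_trans (_ : x * y * entropy n A B <= _).
  (* From [(1 - x) * (1 - y) >= 0], whatever the size of [d]. *)
  have xy : 1 - 2 * d <= x * y by nra.
  apply: le_trans (ler_wpM2r gap0 xy).
  by nra.
have l2 : 0 < ln 2 :> R by rewrite ln_gt0 // ltr1n.
have /tileableP := tMN.
have := ribbon_tilings_blocks n0 nA nB tMN.
have : (0 < #|ribbon_tilings n A B|)%N by rewrite dvd_ribbon_tilings // nA.
rewrite !entropyE; move: #|_| #|_| => T S S0 ST T0.
have lnST : (M %/ A)%:R * (N %/ B)%:R * ln S%:R <= ln T%:R :> R.
  have Sk : (0 < S ^ (M %/ A * (N %/ B)))%N by rewrite expn_gt0 S0.
  have := ln_natr_le R Sk ST.
  by rewrite natrX lnXn ?ltr0n // -[_ *+ (_ * _)%N]mulr_natl natrM.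
have -> : x * y * (n%:R / ln 2 * (ln S%:R / (A * B)%:R)) =
    n%:R / ln 2 * ((M %/ A)%:R * (N %/ B)%:R * ln S%:R / (M * N)%:R).
  rewrite /x /y !natrM; field.
  by rewrite !pnatr_eq0 -!lt0n ?A0 ?B0 ?M0 ?N0 (gt_eqF l2).
rewrite ler_wpM2l ?divr_ge0 ?(ltW l2) //.
by rewrite ler_wpM2r // invr_ge0.
Qed.

Lemma entropy_square_ge (R : realType) n : (0 < n)%N ->
  log2 n%:R - log2 (expR 1)
    + n%:R^-1 * (2^-1 * log2 n%:R + log2 (Num.sqrt (2 * pi))) <= entropy n n n :> R.
Proof.
move=> n0; have l2 : 0 < ln 2 :> R by rewrite ln_gt0 // ltr1n.
have nR : 0 < n%:R :> R by rewrite ltr0n.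
(* Here [a], [f], [T], [s], [l] stand for the logarithms of [n], [n!], the number of tilings,
   [sqrt (2 pi)] and 2, and [x] for [n]. *)
have aux (a f T s l x : R) : 0 < l -> 0 < x ->
    s <= f - (x + 2^-1) * a + x -> f <= T ->
    a / l - 1 / l + x^-1 * (2^-1 * (a / l) + s / l) <= x / l * (T / (x * x)).
  move=> l0 x0 H1 H2.
  have -> : a / l - 1 / l + x^-1 * (2^-1 * (a / l) + s / l) =
    x / l * ((s + (x + 2^-1) * a - x) / (x * x)) by field; rewrite !gt_eqF.
  rewrite ler_wpM2l ?divr_ge0 ?(ltW l0) ?(ltW x0) //.
  rewrite ler_wpM2r ?invr_ge0 ?mulr_ge0 ?(ltW x0) //.
  by lra.
rewrite entropyE /log2 expRK natrM.
apply (aux _ _ _ _ _ _ l2 nR (ln_sqrt_2pi_le_stirling_log n0)).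
apply (ln_natr_le R (fact_gt0 n) (fact_le_ribbon_tilings n)).
Qed.

Definition entropies {R : realType} n : set R :=
  [set x | exists a b, [/\ (0 < a)%N, (0 < b)%N, tileable n a b & x = entropy n a b]].

Lemma entropies_ub (R : realType) n : has_ubound (entropies n : set R).
Proof. by exists (2 * n%:R) => _ [a [b [_ _ _ ->]]]; apply: entropy_le. Qed.

Lemma entropies_nonempty (R : realType) n : (0 < n)%N ->
  (entropies n : set R) !=set0.
Proof.
move=> n0; exists (entropy n n n), n, n; split=> //.
by apply/tileableP => //; rewrite dvd_ribbon_tilings ?dvdnn.
Qed.

(** Fekete's argument: blocks of nearly optimal entropy fill almost all of a large rectangle, while
    no entropy exceeds the supremum. *)
Lemma entropy_cvg_sup (R : realType) n (M N : nat -> nat) : (0 < n)%N ->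
  M t @[t --> \oo] --> \oo -> N t @[t --> \oo] --> \oo ->
  (forall t, tileable n (M t) (N t)) ->
  entropy n (M t) (N t) @[t --> \oo] --> sup (entropies n : set R).
Proof.
move=> n0 hM hN hT.
have [ub ne] := (@entropies_ub R n, @entropies_nonempty R n n0).
apply/cvgrPdist_lt => e e0.
have [_ [a [b [a0 b0 Tab ->]]] lt_ab] :=
  sup_adherent (divr_gt0 e0 (ltr0n R 2)) (conj ne ub).
have nR : 0 < n%:R :> R by rewrite ltr0n.
(* This ratio makes the block loss [4 * n * d] equal to [e / 2]; the other half of [e] goes to the
   choice of [a] and [b]. *)
have d0 : 0 < e / (8 * n%:R) by rewrite divr_gt0 ?mulr_gt0.
set d := e / _ in d0.
have far (A : nat) (f : nat -> nat) : f t @[t --> \oo] --> \oo ->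
    \forall t \near \oo, A%:R <= d * (f t)%:R.
  move=> /cvgnyPge /(_ (Num.bound (A%:R / d))); apply: filterS => t At.
  rewrite -ler_pdivrMl // mulrC; apply: ltW.
  apply: lt_le_trans (archi_boundP _) _; first by rewrite divr_ge0 ?(ltW d0).
  by rewrite ler_nat.
near=> t.
have Mt0 : (0 < M t)%N by near: t; apply: (cvgnyPgt _).1.
have Nt0 : (0 < N t)%N by near: t; apply: (cvgnyPgt _).1.
have le_sup : entropy n (M t) (N t) <= sup (entropies n : set R).
  by apply: (ub_le_sup ub); exists (M t), (N t).
rewrite ger0_norm ?subr_ge0 // ltrBlDr -ltrBlDl.
apply: lt_le_trans (_ : entropy n (n * a) (n * b) - 4 * n%:R * d <= _); last first.
  apply: entropy_ge_blocks => //; rewrite ?muln_gt0 ?n0 ?dvdn_mulr //.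
    by near: t; apply: far.
  by near: t; apply: far.
have -> : 4 * n%:R * d = e / 2 by rewrite /d; field; rewrite gt_eqF.
rewrite ltrBrDr; apply: lt_le_trans (entropy_scale R n0 Tab).
by move: lt_ab; lra.
Unshelve. all: end_near. Qed.

Theorem theorem2p3 (R : realType) (n : nat) (hn : (1 <= n)%N)
    (M N : nat -> nat)
    (hM : M t @[t --> \oo] --> \oo) (hN : N t @[t --> \oo] --> \oo)
    (hT : forall t, tileable n (M t) (N t)) :
  let u : R ^nat := fun t => entropy n (M t) (N t) in
  cvgn u /\
  log2 n%:R - log2 (expR 1)
    + n%:R^-1 * (2^-1 * log2 n%:R + log2 (Num.sqrt (2 * pi))) <= limn u.
Proof.
move=> u.
have cvu : u @ \oo --> sup (entropies n : set R) by apply: entropy_cvg_sup.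
split; first by apply/cvg_ex; exists (sup (entropies n : set R)).
(* The limit is a supremum over a set that contains the entropy of the [n] by [n] square. *)
rewrite (cvg_lim _ cvu) //; apply: le_trans (entropy_square_ge R hn) _.
apply: (ub_le_sup (@entropies_ub R n)).
exists n, n; split=> //.
by apply/tileableP => //; rewrite dvd_ribbon_tilings ?dvdnn.
Qed.
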